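(* Let $\mathbf{x}\in\mathbb{R}^{N}$ be a $K$-sparse signal, and let $\mathbf{y}=\mathbf{\Phi}\mathbf{x}\in\mathbb{R}^{m}$ be its measurement under the sampling matrix $\mathbf{\Phi}\in\mathbb{R}^{m\times N}$. If $\mathbf{\Phi}$ satisfies the RIP with constant $\delta_{3K}<0.165$, then the subspace pursuit (SP) algorithm with input $(K,\mathbf{\Phi},\mathbf{y})$ exactly recovers $\mathbf{x}$ from $\mathbf{y}$ via a finite number of iterations; that is, there is a finite $\ell_0\ge 0$ such that for every $\ell\ge\ell_0$ the estimate $\hat{\mathbf{x}}$ determined by $T^{\ell}$ (namely $\hat{\mathbf{x}}_{T^{\ell}}=\mathbf{\Phi}_{T^{\ell}}^{\dagger}\mathbf{y}$ and $\hat{\mathbf{x}}_{\{1,\dots,N\}-T^{\ell}}=\mathbf{0}$) equals $\mathbf{x}$.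
   Context: Notation: for an index set $I\subset\{1,\dots,N\}$, $\mathbf{\Phi}_I$ is the submatrix of columns of $\mathbf{\Phi}$ indexed by $I$ and $\mathbf{x}_I$ is the vector of entries of $\mathbf{x}$ indexed by $I$. $^*$ denotes transposition. $\mathbf{x}$ is $K$-sparse if it has at most $K$ nonzero entries. When $\mathbf{\Phi}_I^*\mathbf{\Phi}_I$ is invertible, $\mathbf{\Phi}_I^{\dagger}:=(\mathbf{\Phi}_I^*\mathbf{\Phi}_I)^{-1}\mathbf{\Phi}_I^*$, $\mathrm{proj}(\mathbf{y},\mathbf{\Phi}_I):=\mathbf{\Phi}_I\mathbf{\Phi}_I^{\dagger}\mathbf{y}$ and $\mathrm{resid}(\mathbf{y},\mathbf{\Phi}_I):=\mathbf{y}-\mathrm{proj}(\mathbf{y},\mathbf{\Phi}_I)$. RIP: for $K\le m$ and $0\le\delta\le1$, $\mathbf{\Phi}$ satisfies the RIP with parameters $(K,\delta)$ if $(1-\delta)\|\mathbf{q}\|_2^2\le\|\mathbf{\Phi}_I\mathbf{q}\|_2^2\le(1+\delta)\|\mathbf{q}\|_2^2$ for all $I\subset\{1,\dots,N\}$ with $|I|\le K$ and all $\mathbf{q}\in\mathbb{R}^{|I|}$. The RIP constant $\delta_K$ is the infimum of all such $\delta$. SP algorithm with input $(K,\mathbf{\Phi},\mathbf{y})$. Initialization: $T^0$ is the set of $K$ indices of the largest-magnitude entries of $\mathbf{\Phi}^*\mathbf{y}$, and $\mathbf{y}_r^0=\mathrm{resid}(\mathbf{y},\mathbf{\Phi}_{T^0})$.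 Iteration $\ell=1,2,\dots$: (1) $\tilde T^{\ell}=T^{\ell-1}\cup\{K$ indices of the largest-magnitude entries of $\mathbf{\Phi}^*\mathbf{y}_r^{\ell-1}\}$; (2) $\mathbf{x}_p=\mathbf{\Phi}_{\tilde T^{\ell}}^{\dagger}\mathbf{y}$ (a vector indexed by $\tilde T^{\ell}$); (3) $T^{\ell}$ is the set of the $K$ indices in $\tilde T^{\ell}$ of the largest-magnitude entries of $\mathbf{x}_p$; (4) $\mathbf{y}_r^{\ell}=\mathrm{resid}(\mathbf{y},\mathbf{\Phi}_{T^{\ell}})$; (5) if $\|\mathbf{y}_r^{\ell}\|_2>\|\mathbf{y}_r^{\ell-1}\|_2$, set $T^{\ell}=T^{\ell-1}$ and quit the iteration. Ties are broken arbitrarily. Output: $\hat{\mathbf{x}}$ with $\hat{\mathbf{x}}_{\{1,\dots,N\}-T^{\ell}}=\mathbf{0}$ and $\hat{\mathbf{x}}_{T^{\ell}}=\mathbf{\Phi}_{T^{\ell}}^{\dagger}\mathbf{y}$. If the algorithm has quit, $T^{\ell}$ is kept constant for all later $\ell$. *)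

(* Defs.v *)
From mathcomp Require Import all_boot all_order all_algebra.
From mathcomp Require Import all_classical all_reals ereal.

Set Implicit Arguments.
Unset Strict Implicit.
Unset Printing Implicit Defensive.

Import Order.TTheory GRing.Theory Num.Theory.

Local Open Scope ring_scope.

(* The library norm [`|v|] on matrices is the sup norm, hence this definition. *)
Definition norm2 (R : realType) (n : nat) (v : 'cV[R]_n) : R :=
  Num.sqrt (\sum_i v i 0 ^+ 2).

Definition sparse (R : realType) (N K : nat) (x : 'cV[R]_N) : bool :=
  (#|[set i | (x i 0 != 0)%R]| <= K)%N.

(* The columns of [Phi] in [I], listed in increasing order of index. *)
Definition cols (R : realType) (m N : nat) (Phi : 'M[R]_(m, N))
    (I : {set 'I_N}) : 'M[R]_(m, #|I|) :=
  colsub (fun k : 'I_#|I| => enum_val k) Phi.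

(* Inverse of [cols]'s indexing: the vector of [R^N] whose restriction to [I]
   is [v] and which vanishes off [I]; see [zext_in] and [zext_out]. *)
Definition zext (R : realType) (N : nat) (I : {set 'I_N}) (v : 'cV[R]_#|I|) :
    'cV[R]_N :=
  \col_i \sum_(k < #|I| | enum_val k == i) v k 0.

Lemma zext_in (R : realType) (N : nat) (I : {set 'I_N}) (v : 'cV[R]_#|I|) :
  rowsub (fun k : 'I_#|I| => enum_val k) (zext v) = v.
Proof.
apply/matrixP => k j; rewrite !mxE ord1 (bigD1 k) //= big1 ?addr0 // => l.
by case/andP=> /eqP /enum_val_inj ->; rewrite eqxx.
Qed.

Lemma zext_out (R : realType) (N : nat) (I : {set 'I_N}) (v : 'cV[R]_#|I|)
    (i : 'I_N) :
  i \notin I -> zext v i 0 = 0.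
Proof.
move=> iI; rewrite mxE big1 // => k /eqP ki.
by move: iI; rewrite -ki enum_valP.
Qed.

(* Meaningful when [A^T *m A] is invertible; [invmx] is the identity map on
   singular matrices. *)
Definition pinv (R : realType) (m n : nat) (A : 'M[R]_(m, n)) : 'M[R]_(n, m) :=
  invmx (A^T *m A) *m A^T.

Definition proj (R : realType) (m n : nat) (y : 'cV[R]_m) (A : 'M[R]_(m, n)) :
    'cV[R]_m :=
  A *m (pinv A *m y).

Definition resid (R : realType) (m n : nat) (y : 'cV[R]_m) (A : 'M[R]_(m, n)) :
    'cV[R]_m :=
  y - proj y A.

Definition RIP (R : realType) (m N : nat) (Phi : 'M[R]_(m, N)) (K : nat)
    (delta : R) : Prop :=
  [/\ (K <= m)%N, 0 <= delta <= 1 &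
      forall (I : {set 'I_N}) (q : 'cV[R]_#|I|), (#|I| <= K)%N ->
        (1 - delta) * norm2 q ^+ 2 <= norm2 (cols Phi I *m q) ^+ 2
          <= (1 + delta) * norm2 q ^+ 2].

(* Extended-real valued, so that it is [+oo] when [Phi] satisfies the RIP of
   order [K] for no parameter at all (in particular when [m < K]). *)
Definition RIP_const (R : realType) (m N : nat) (Phi : 'M[R]_(m, N))
    (K : nat) : \bar R :=
  ereal_inf [set delta%:E | delta in [set delta | RIP Phi K delta]]%classic.

(* [J] is a possible outcome, for some way of breaking ties, of choosing the
   [K] indices in [A] of the largest-magnitude entries of [v]. *)
Definition largest (R : realType) (N K : nat) (A : {set 'I_N}) (v : 'cV[R]_N)
    (J : {set 'I_N}) : Prop :=
  [/\ J \subset A, #|J| = K &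
      forall i j, i \in J -> j \in A :\: J -> `|v j 0| <= `|v i 0|].

(* Steps (expand, project, prune) of one iteration: [T'] is a possible new
   index set computed from [T], before the residuals are compared. *)
Definition sp_candidate (R : realType) (m N K : nat) (Phi : 'M[R]_(m, N))
    (y : 'cV[R]_m) (T T' : {set 'I_N}) : Prop :=
  exists2 J : {set 'I_N},
    largest K [set: 'I_N] (Phi^T *m resid y (cols Phi T)) J &
    let Tt := T :|: J in largest K Tt (zext (pinv (cols Phi Tt) *m y)) T'.

(* A state is the current index set together with a flag telling whether the
   algorithm has quit.  The flag is needed because ties are broken arbitrarily:
   a repeated iteration from the same index set could come out differently. *)
Definition sp_step (R : realType) (m N K : nat) (Phi : 'M[R]_(m, N))
    (y : 'cV[R]_m) (s s' : {set 'I_N} * bool) : Prop :=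
  if s.2 then s' = s
  else exists2 T' : {set 'I_N}, sp_candidate K Phi y s.1 T' &
    s' = if norm2 (resid y (cols Phi s.1)) < norm2 (resid y (cols Phi T'))
         then (s.1, true) else (T', false).

Definition sp_run (R : realType) (m N K : nat) (Phi : 'M[R]_(m, N))
    (y : 'cV[R]_m) (s : nat -> {set 'I_N} * bool) : Prop :=
  [/\ largest K [set: 'I_N] (Phi^T *m y) (s 0%N).1,
      (s 0%N).2 = false &
      forall l, sp_step K Phi y (s l) (s l.+1)].

Definition sp_estimate (R : realType) (m N : nat) (Phi : 'M[R]_(m, N))
    (y : 'cV[R]_m) (T : {set 'I_N}) : 'cV[R]_N :=
  zext (pinv (cols Phi T) *m y).

(* Main.v *)
Require Import Defs.
From mathcomp Require Import all_boot all_order all_algebra.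
From mathcomp Require Import all_classical all_reals ereal.
From mathcomp Require Import ring lra zify.

Set Implicit Arguments.
Unset Strict Implicit.
Unset Printing Implicit Defensive.

Import Order.TTheory GRing.Theory Num.Theory.

Local Open Scope ring_scope.

(** Let [S] be the support of [x], [e := x - z] the error of the estimate [z]
    computed from a [K]-element set [T], and [r := Phi *m e] its residual.

    The whole proof rests on one consequence of the restricted isometry
    property, [RIP_gram]: on vectors carried by a common set of at most [3 * K]
    indices, the Gram matrix [Phi^T *m Phi] differs from the identity by an
    operator of norm at most [delta].  Two facts about [z] come from least
    squares: the correlations [g := Phi^T *m r] vanish on [T]
    ([normal_equations]), and [z] minimises the residual among vectors
    supported in [T] ([resid_min]).

    Each of the two selections in an iteration is a thresholding of a vector
    that approximates something supported in [S]: expansion thresholds [g],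
    which approximates [e] off [T]; pruning thresholds the least squares
    solution on the expanded set, which approximates [x].  A thresholding that
    keeps [K] indices can lose only entries of the approximated vector that are
    comparable with the approximation error ([largest_missed]).  Hence, writing
    [A] for the expanded set, [e'] for the least squares error on [A] and [T']
    for the pruned set, the squared norms satisfy
      - |x_(S \ A)|^2 <= 2 delta^2 |e|^2                   ([expand_missed]),
      - |e'_A|^2 <= delta^2 |e'|^2                         ([error_inside]),
      - (1 - delta^2) |e'|^2 <= |x_(S \ A)|^2              ([error_missed]),
      - |x_(S \ T')|^2 <= |x_(S \ A)|^2 + 2 |e'_A|^2       ([prune_missed]).
    The squared residual at [T] is at least (1 - delta) |e|^2, and the one at
    [T'] is at most (1 + delta) |x_(S \ T')|^2.  The property weakens as delta
    grows ([RIP_weaken]), so delta may be taken to be 0.165, and these bounds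
    combine to a squared residual that shrinks by a factor less than 1/4
    ([sp_contraction]); the true factor is about 0.173.

    So a nonzero residual strictly decreases and the algorithm does not quit.
    There are finitely many index sets, so the residual reaches zero, and it
    remains zero whether or not the algorithm quits.  A zero residual means
    [Phi *m e = 0] with [e] supported on at most [2 * K] indices, which forces
    [e = 0]. *)

(** * Euclidean inner product *)

Definition dot (R : realType) (n : nat) (u v : 'cV[R]_n) : R := (u^T *m v) 0 0.

Lemma dotE (R : realType) (n : nat) (u v : 'cV[R]_n) :
  dot u v = \sum_i u i 0 * v i 0.
Proof. by rewrite /dot mxE; apply: eq_bigr => i _; rewrite mxE. Qed.

Lemma dotC (R : realType) (n : nat) (u v : 'cV[R]_n) : dot u v = dot v u.
Proof. by rewrite !dotE; apply: eq_bigr => i _; rewrite mulrC. Qed.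

Lemma dotDr (R : realType) (n : nat) (u v w : 'cV[R]_n) :
  dot u (v + w) = dot u v + dot u w.
Proof. by rewrite /dot mulmxDr mxE. Qed.

Lemma dotZr (R : realType) (n : nat) (a : R) (u v : 'cV[R]_n) :
  dot u (a *: v) = a * dot u v.
Proof. by rewrite /dot -scalemxAr mxE. Qed.

Lemma dotBr (R : realType) (n : nat) (u v w : 'cV[R]_n) :
  dot u (v - w) = dot u v - dot u w.
Proof. by rewrite dotDr -scaleN1r dotZr mulN1r. Qed.

Lemma dot_sqrD (R : realType) (n : nat) (u v : 'cV[R]_n) :
  dot (u + v) (u + v) = dot u u + 2 * dot u v + dot v v.
Proof. by rewrite dotDr !(dotC (u + v)) !dotDr (dotC v u); ring. Qed.

Lemma dot_mulmx (R : realType) (m n : nat) (A : 'M[R]_(m, n)) (u : 'cV[R]_n)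
    (v : 'cV[R]_m) :
  dot (A *m u) v = dot u (A^T *m v).
Proof. by rewrite /dot trmx_mul mulmxA. Qed.

Lemma dot_sq (R : realType) (n : nat) (u : 'cV[R]_n) :
  dot u u = \sum_i u i 0 ^+ 2.
Proof. by rewrite dotE; apply: eq_bigr => i _; rewrite expr2. Qed.

Lemma dot_ge0 (R : realType) (n : nat) (u : 'cV[R]_n) : 0 <= dot u u.
Proof. by rewrite dot_sq sumr_ge0 // => i _; rewrite sqr_ge0. Qed.

Lemma dot_eq0 (R : realType) (n : nat) (u : 'cV[R]_n) :
  dot u u = 0 -> u = 0.
Proof.
rewrite dot_sq => /eqP; rewrite psumr_eq0; last by move=> i _; rewrite sqr_ge0.
move=> /allP u0; apply/colP => i; rewrite mxE; apply/eqP.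
by have := u0 i; rewrite mem_index_enum sqrf_eq0; apply.
Qed.

Lemma norm2_sq (R : realType) (n : nat) (u : 'cV[R]_n) :
  norm2 u ^+ 2 = dot u u.
Proof. by rewrite /norm2 -dot_sq sqr_sqrtr // dot_ge0. Qed.

(** * Vectors supported in an index set *)

Definition supported (R : realType) (N : nat) (I : {set 'I_N}) (u : 'cV[R]_N) :=
  forall i, i \notin I -> u i 0 = 0.

Definition restr (R : realType) (N : nat) (I : {set 'I_N}) (u : 'cV[R]_N) :
    'cV[R]_N :=
  \col_i (if i \in I then u i 0 else 0).

Lemma restr_supported (R : realType) (N : nat) (I : {set 'I_N})
    (u : 'cV[R]_N) : supported I (restr I u).
Proof. by move=> i /negbTE iI; rewrite mxE iI. Qed.

Lemma supportedS (R : realType) (N : nat) (I J : {set 'I_N}) (u : 'cV[R]_N) :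
  I \subset J -> supported I u -> supported J u.
Proof.
by move=> /fintype.subsetP IJ uI i iJ; apply: uI; apply: contra iJ => /IJ.
Qed.

Lemma supportedD (R : realType) (N : nat) (I : {set 'I_N}) (u v : 'cV[R]_N) :
  supported I u -> supported I v -> supported I (u + v).
Proof. by move=> uI vI i iI; rewrite mxE uI // vI // addr0. Qed.

Lemma supportedZ (R : realType) (N : nat) (I : {set 'I_N}) (a : R)
    (u : 'cV[R]_N) : supported I u -> supported I (a *: u).
Proof. by move=> uI i iI; rewrite mxE uI // mulr0. Qed.

Lemma supportedB (R : realType) (N : nat) (I : {set 'I_N}) (u v : 'cV[R]_N) :
  supported I u -> supported I v -> supported I (u - v).
Proof. by move=> uI vI i iI; rewrite !mxE uI // vI // subr0. Qed.

Lemma dot_restr (R : realType) (N : nat) (I : {set 'I_N}) (u v : 'cV[R]_N) :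
  dot (restr I u) v = \sum_(i in I) u i 0 * v i 0.
Proof.
rewrite dotE [RHS]big_mkcond; apply: eq_bigr => i _; rewrite mxE.
by case: (i \in I); rewrite ?mul0r.
Qed.

Lemma sumsq_subset (R : realType) (N : nat) (I J : {set 'I_N}) (u : 'cV[R]_N) :
  I \subset J -> \sum_(i in I) u i 0 ^+ 2 <= \sum_(i in J) u i 0 ^+ 2.
Proof.
move=> IJ; rewrite [leRHS](big_setID I) /= (finset.setIidPr IJ) lerDl.
by rewrite sumr_ge0 // => i _; rewrite sqr_ge0.
Qed.

Lemma supported_dot (R : realType) (N : nat) (I : {set 'I_N}) (u : 'cV[R]_N) :
  supported I u -> dot u u = \sum_(i in I) u i 0 ^+ 2.
Proof.
move=> uI; rewrite dot_sq [RHS]big_mkcond; apply: eq_bigr => i _.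
by case: ifPn => // /uI ->; rewrite expr0n.
Qed.

Lemma zext_supported (R : realType) (N : nat) (I : {set 'I_N})
    (v : 'cV[R]_#|I|) : supported I (zext v).
Proof. by move=> i; apply: zext_out. Qed.

Lemma zext_rowsub (R : realType) (N : nat) (I : {set 'I_N}) (u : 'cV[R]_N) :
  supported I u -> zext (rowsub (fun k : 'I_#|I| => enum_val k) u) = u.
Proof.
move=> uI; apply/colP => i; have [iI|iI] := boolP (i \in I); last first.
  by rewrite zext_out // uI.
have := zext_in (rowsub (fun k : 'I_#|I| => enum_val k) u).
by move=> /colP /(_ (enum_rank_in iI i)); rewrite !mxE enum_rankK_in.
Qed.

Lemma mul_cols (R : realType) (m N : nat) (Phi : 'M[R]_(m, N))
    (I : {set 'I_N}) (v : 'cV[R]_#|I|) :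
  cols Phi I *m v = Phi *m zext v.
Proof.
apply/colP => i; rewrite !mxE.
under [RHS]eq_bigr => j _ do rewrite mxE big_distrr /=.
rewrite (exchange_big_dep xpredT) //=; apply: eq_bigr => k _.
rewrite mxE (eq_bigl (pred1 (enum_val k))) ?big_pred1_eq // => j.
by rewrite /= eq_sym.
Qed.

Lemma dot_zext (R : realType) (N : nat) (I : {set 'I_N}) (v : 'cV[R]_#|I|) :
  dot (zext v) (zext v) = dot v v.
Proof.
rewrite (supported_dot (@zext_supported _ _ _ v)) dot_sq big_enum_val /=.
apply: eq_bigr => k _; congr (_ ^+ 2).
by have /colP/(_ k) := zext_in v; rewrite mxE.
Qed.

(** * Consequences of the restricted isometry property *)

(** Trades the column submatrices of [RIP] for vectors of the ambient space, in
    which different index sets can be compared without reindexing. *)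
Lemma RIP_dot (R : realType) (m N n : nat) (Phi : 'M[R]_(m, N)) (delta : R)
    (I : {set 'I_N}) (u : 'cV[R]_N) :
  RIP Phi n delta -> (#|I| <= n)%N -> supported I u ->
  (1 - delta) * dot u u <= dot (Phi *m u) (Phi *m u) <= (1 + delta) * dot u u.
Proof.
case=> _ _ rip In uI.
have := rip I (rowsub (fun k : 'I_#|I| => enum_val k) u) In.
by rewrite !norm2_sq mul_cols -dot_zext zext_rowsub.
Qed.

(** [Phi^T *m Phi - 1], compressed to [I], is a symmetric operator whose
    quadratic form is bounded by [delta], so its norm is at most [delta].  This
    is the polarisation argument with [t] the image of [e] under the operator,
    scaled so that square roots are avoided. *)
Lemma RIP_gram (R : realType) (m N n : nat) (Phi : 'M[R]_(m, N)) (delta : R)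
    (I : {set 'I_N}) (e : 'cV[R]_N) :
  RIP Phi n delta -> (#|I| <= n)%N -> supported I e ->
  \sum_(i in I) (Phi^T *m (Phi *m e) - e) i 0 ^+ 2
    <= delta ^+ 2 * dot e e.
Proof.
move=> rip In eI; have [_ /andP[d0 _] _] := rip.
set h := Phi^T *m (Phi *m e) - e; set t := restr I h.
have tI : supported I t by exact: restr_supported.
have -> : \sum_(i in I) h i 0 ^+ 2 = dot t t.
  by rewrite (supported_dot tI); apply: eq_bigr => i iI; rewrite [t i 0]mxE iI.
have tE : dot t t = dot (Phi *m t) (Phi *m e) - dot t e.
  rewrite (supported_dot tI) dot_mulmx -dotBr -/h dot_restr.
  by apply: eq_bigr => i iI; rewrite [t i 0]mxE iI expr2.
(* The bounds at [t + a *: e] and [t - a *: e], subtracted. *)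
have key (a : R) : 2 * a * dot t t <= delta * (dot t t + a ^+ 2 * dot e e).
  have := RIP_dot rip In (supportedD tI (supportedZ a eI)).
  have := RIP_dot rip In (supportedD tI (supportedZ (- a) eI)).
  rewrite !mulmxDr -!scalemxAr !dot_sqrD !dotZr !(dotC (_ *: _)) !dotZr.
  by rewrite tE => /andP[lo1 hi1] /andP[lo2 hi2]; lra.
(* In the extremal case [|t| = delta * |e|] the bound of [key] is tight for
   [a = delta]; that choice says nothing when [delta = 0]. *)
have [d_eq0 | dN0] := eqVneq delta 0.
  by have := key 1; rewrite d_eq0; lra.
have dp : 0 < delta by rewrite lt_def dN0.
by rewrite -(ler_pM2l dp); have := key delta; lra.
Qed.

Lemma RIP_weaken (R : realType) (m N n : nat) (Phi : 'M[R]_(m, N))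
    (delta delta' : R) :
  delta <= delta' <= 1 -> RIP Phi n delta -> RIP Phi n delta'.
Proof.
move=> /andP[dd' d'1] [nm /andP[d0 _] rip]; split=> // [|I q In].
  by rewrite d'1 andbT (le_trans d0).
have /andP[lo hi] := rip I q In; have q0 := sqr_ge0 (norm2 q).
apply/andP; split; first by apply: le_trans lo; rewrite ler_wpM2r // lerB.
by apply: le_trans hi _; rewrite ler_wpM2r // lerD.
Qed.

(** * Selecting the largest entries *)

Lemma ler_sum_dominated (R : realType) (T : finType) (P Q : {set T})
    (F : T -> R) :
  (#|P| <= #|Q|)%N -> (forall i, 0 <= F i) ->
  (forall i j, i \in Q -> j \in P -> F j <= F i) ->
  \sum_(j in P) F j <= \sum_(i in Q) F i.
Proof.
move=> PQ F0 FQP; have [->|[j0 j0P]] := set_0Vmem P.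
  by rewrite big_set0 sumr_ge0.
case: (Order.TotalTheory.arg_maxP F j0P) => j jP jmax.
apply: (@le_trans _ _ (F j *+ #|P|)).
  by rewrite -sumr_const; apply: ler_sum => k kP; exact: jmax.
apply: (@le_trans _ _ (F j *+ #|Q|)); first exact: ler_wpMn2l.
by rewrite -sumr_const; apply: ler_sum => i iQ; exact: FQP.
Qed.

(** Selection among all indices is selection among fewer candidates too, which
    confines the error term of [largest_missed] to a small set. *)
Lemma largestS (R : realType) (N K : nat) (A B : {set 'I_N}) (v : 'cV[R]_N)
    (J : {set 'I_N}) :
  J \subset B -> B \subset A -> largest K A v J -> largest K B v J.
Proof.
move=> JB BA [_ JK Jmax]; split=> // i j iJ /setDP[jB jJ]; apply: Jmax => //.
by rewrite inE jJ (fintype.subsetP BA).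
Qed.

(** As [S] has no more elements than [J], the missed indices [P] of [S] are no
    more numerous than the spurious ones [Q], and [v] is larger on [Q] than on
    [P].  On [Q] the vector [u] vanishes, so [v] there is pure error; on [P] the
    entries of [u] are bounded by those of [v] plus error.  Since [P] and [Q]
    are disjoint, each error entry is counted once. *)
Lemma largest_missed (R : realType) (N K : nat) (A S : {set 'I_N})
    (u v : 'cV[R]_N) (J : {set 'I_N}) :
  largest K A v J -> (#|S| <= K)%N -> supported S u ->
  \sum_(i in A :\: J) u i 0 ^+ 2
    <= 2 * \sum_(i in A) (v - u) i 0 ^+ 2.
Proof.
move=> [JA JK Jmax] SK uS.
set P := (S :&: A) :\: J; set Q := J :\: S.
have PQ : (#|P| <= #|Q|)%N.
  have : (#|S| <= #|J|)%N by rewrite JK.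
  rewrite -(cardsID J S) -(cardsID S J) finset.setIC leq_add2l.
  apply: leq_trans; apply: subset_leq_card.
  by rewrite finset.setSD // finset.subsetIl.
have disjPQ : [disjoint P & Q].
  rewrite disjoint_subset; apply/fintype.subsetP => i.
  by rewrite !inE => /and3P[/negbTE-> -> _].
have PQA : P :|: Q \subset A.
  rewrite finset.subUset; apply/andP; split; last first.
    exact: fintype.subset_trans (finset.subsetDl _ _) JA.
  exact: fintype.subset_trans (finset.subsetDl _ _) (finset.subsetIr _ _).
have vPQ : \sum_(i in P) v i 0 ^+ 2 <= \sum_(i in Q) v i 0 ^+ 2.
  apply: ler_sum_dominated => // [i|i j]; first exact: sqr_ge0.
  rewrite !inE => /andP[_ iJ] /and3P[jJ _ jA].
  rewrite -(real_normK (num_real (v j 0))) -(real_normK (num_real (v i 0))).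
  by rewrite lerXn2r ?nnegrE ?normr_ge0 // Jmax // inE jJ.
have -> : \sum_(i in A :\: J) u i 0 ^+ 2 = \sum_(i in P) u i 0 ^+ 2.
  rewrite [RHS]big_mkcond [LHS]big_mkcond; apply: eq_bigr => i _.
  rewrite !inE; case: (boolP (i \in S)) => //= /uS ->.
  by rewrite expr0n andbF; case: ifP.
have uP : \sum_(i in P) u i 0 ^+ 2
    <= 2 * \sum_(i in P) v i 0 ^+ 2 + 2 * \sum_(i in P) (v - u) i 0 ^+ 2.
  rewrite !big_distrr -big_split /=; apply: ler_sum => i _.
  by rewrite !mxE; have := sqr_ge0 (2 * v i 0 - u i 0); lra.
have vQ : \sum_(i in Q) v i 0 ^+ 2 = \sum_(i in Q) (v - u) i 0 ^+ 2.
  apply: eq_bigr => i; rewrite !inE => /andP[/uS iS _].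
  by rewrite !mxE iS subr0.
have sumPQ (F : 'I_N -> R) :
    \sum_(i in P :|: Q) F i = \sum_(i in P) F i + \sum_(i in Q) F i.
  by rewrite -bigU //; apply: eq_bigl => i; rewrite !inE.
have := sumsq_subset (v - u) PQA; rewrite sumPQ.
by lra.
Qed.

(** * Least squares on an index set *)

(** A vector killed by the Gram matrix is killed by [cols Phi I], since the
    quadratic form of the Gram matrix is a squared norm; the lower bound of the
    restricted isometry property then makes it zero. *)
Lemma gram_unit (R : realType) (m N n : nat) (Phi : 'M[R]_(m, N)) (delta : R)
    (I : {set 'I_N}) :
  RIP Phi n delta -> delta < 1 -> (#|I| <= n)%N ->
  (cols Phi I)^T *m cols Phi I \in unitmx.
Proof.
move=> rip d1 In; rewrite unitmxE unitfE; apply/det0P => -[v vN0 vG0].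
case/eqP: vN0; set A := cols Phi I in vG0 *.
have : dot (A *m v^T) (A *m v^T) = 0.
  by rewrite dot_mulmx /dot trmxK !mulmxA -(mulmxA v) vG0 mul0mx mxE.
rewrite /A mul_cols => Av0.
have := RIP_dot rip In (@zext_supported _ _ _ v^T); rewrite Av0 dot_zext.
have := dot_ge0 v^T => vv0 /andP[vv _].
have /dot_eq0/(congr1 trmx) : dot v^T v^T = 0 by nra.
by rewrite trmxK trmx0.
Qed.

Lemma resid_estimate (R : realType) (m N : nat) (Phi : 'M[R]_(m, N))
    (y : 'cV[R]_m) (I : {set 'I_N}) :
  resid y (cols Phi I) = y - Phi *m sp_estimate Phi y I.
Proof. by rewrite /resid /Defs.proj mul_cols. Qed.

Lemma estimate_supported (R : realType) (m N : nat) (Phi : 'M[R]_(m, N))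
    (y : 'cV[R]_m) (I : {set 'I_N}) : supported I (sp_estimate Phi y I).
Proof. exact: zext_supported. Qed.

Lemma normal_equations (R : realType) (m N n : nat) (Phi : 'M[R]_(m, N))
    (delta : R) (y : 'cV[R]_m) (I : {set 'I_N}) (i : 'I_N) :
  RIP Phi n delta -> delta < 1 -> (#|I| <= n)%N -> i \in I ->
  (Phi^T *m resid y (cols Phi I)) i 0 = 0.
Proof.
move=> rip d1 In iI; have G := gram_unit rip d1 In.
have : (cols Phi I)^T *m resid y (cols Phi I) = 0.
  by rewrite /resid /Defs.proj /pinv mulmxBr !mulmxA mulmxV // mul1mx subrr.
move=> /colP /(_ (enum_rank_in iI i)); rewrite [RHS]mxE => <-.
by rewrite !mxE; apply: eq_bigr => k _; rewrite !mxE enum_rankK_in.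
Qed.

Definition sp_error (R : realType) (m N : nat) (Phi : 'M[R]_(m, N))
    (x : 'cV[R]_N) (T : {set 'I_N}) : 'cV[R]_N :=
  x - sp_estimate Phi (Phi *m x) T.

Lemma resid_error (R : realType) (m N : nat) (Phi : 'M[R]_(m, N))
    (x : 'cV[R]_N) (I : {set 'I_N}) :
  resid (Phi *m x) (cols Phi I) = Phi *m sp_error Phi x I.
Proof. by rewrite resid_estimate /sp_error mulmxBr. Qed.

Lemma error_out (R : realType) (m N : nat) (Phi : 'M[R]_(m, N))
    (x : 'cV[R]_N) (I : {set 'I_N}) (i : 'I_N) :
  i \notin I -> sp_error Phi x I i 0 = x i 0.
Proof.
by move=> iI; rewrite mxE [X in _ + X]mxE estimate_supported // subr0.
Qed.

Lemma error_supported (R : realType) (m N : nat) (Phi : 'M[R]_(m, N))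
    (x : 'cV[R]_N) (S I : {set 'I_N}) :
  supported S x -> supported (S :|: I) (sp_error Phi x I).
Proof.
move=> xS; apply: supportedB; first exact: supportedS (finset.subsetUl _ _) xS.
exact: supportedS (finset.subsetUr _ _) (@estimate_supported _ _ _ _ _ _).
Qed.

(** The correlations [Phi^T *m (Phi *m e)] vanish on [I], so there the error [e]
    equals its own deviation from them, which [RIP_gram] makes small. *)
Lemma error_inside (R : realType) (m N n : nat) (Phi : 'M[R]_(m, N))
    (delta : R) (x : 'cV[R]_N) (S I : {set 'I_N}) :
  RIP Phi n delta -> delta < 1 -> (#|S :|: I| <= n)%N -> supported S x ->
  \sum_(i in I) sp_error Phi x I i 0 ^+ 2
    <= delta ^+ 2 * dot (sp_error Phi x I) (sp_error Phi x I).
Proof.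
move=> rip d1 SIn xS; set e := sp_error Phi x I.
have In : (#|I| <= n)%N.
  exact: leq_trans (subset_leq_card (finset.subsetUr _ _)) SIn.
apply: le_trans (RIP_gram rip SIn (error_supported Phi xS)).
rewrite -/e.
set h := Phi^T *m (Phi *m e) - e.
have -> : \sum_(i in I) e i 0 ^+ 2 = \sum_(i in I) h i 0 ^+ 2.
  apply: eq_bigr => i iI; have := normal_equations (Phi *m x) rip d1 In iI.
  rewrite resid_error -/e => ge; rewrite [in RHS]mxE ge add0r.
  by rewrite [in RHS]mxE sqrrN.
exact: sumsq_subset (finset.subsetUr S I).
Qed.

(** Off [I] the error is [x] itself, and [error_inside] bounds the rest of it by
    a small fraction of the whole: the error is governed by the part of [x]
    that [I] misses. *)
Lemma error_missed (R : realType) (m N n : nat) (Phi : 'M[R]_(m, N))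
    (delta : R) (x : 'cV[R]_N) (S I : {set 'I_N}) :
  RIP Phi n delta -> delta < 1 -> (#|S :|: I| <= n)%N -> supported S x ->
  (1 - delta ^+ 2) * dot (sp_error Phi x I) (sp_error Phi x I)
    <= \sum_(i in S :\: I) x i 0 ^+ 2.
Proof.
move=> rip d1 SIn xS; set e := sp_error Phi x I.
have := error_inside rip d1 SIn xS; rewrite -/e.
have -> : \sum_(i in S :\: I) x i 0 ^+ 2
    = \sum_(i in (S :|: I) :\: I) e i 0 ^+ 2.
  rewrite finset.setDUl finset.setDv finset.setU0; apply: eq_bigr => i.
  by rewrite inE => /andP[iI _]; rewrite /e error_out.
have := supported_dot (error_supported Phi xS (I := I)); rewrite -/e.
rewrite (big_setID I) /= (finset.setIidPr (finset.subsetUr _ _)).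
by move=> ->; lra.
Qed.

(** Pythagoras: changing [w] to the estimate changes the residual by a vector
    orthogonal to it. *)
Lemma resid_min (R : realType) (m N n : nat) (Phi : 'M[R]_(m, N))
    (delta : R) (y : 'cV[R]_m) (I : {set 'I_N}) (w : 'cV[R]_N) :
  RIP Phi n delta -> delta < 1 -> (#|I| <= n)%N -> supported I w ->
  dot (resid y (cols Phi I)) (resid y (cols Phi I))
    <= dot (y - Phi *m w) (y - Phi *m w).
Proof.
move=> rip d1 In wI; set r := resid y (cols Phi I).
set z := sp_estimate Phi y I - w.
have zI : supported I z.
  exact: supportedB (@estimate_supported _ _ _ _ _ _) wI.
have -> : y - Phi *m w = r + Phi *m z.
  by rewrite /r resid_estimate mulmxBr addrA subrK.
have orth : dot r (Phi *m z) = 0.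
  rewrite dotC dot_mulmx dotE big1 // => i _.
  have [iI|/zI ->] := boolP (i \in I); last by rewrite mul0r.
  by rewrite (normal_equations y rip d1 In iI) mulr0.
by rewrite dot_sqrD orth mulr0 addr0 lerDl dot_ge0.
Qed.

(** * One iteration of subspace pursuit *)

(** The correlations [g] approximate the error [e] with precision [delta] on
    the at most [3 * K] indices involved.  They vanish on [T], so they
    approximate at least as well the part of [e] off [T], which is supported in
    [S]; [largest_missed] applies to this part. *)
Lemma expand_missed (R : realType) (m N K : nat) (Phi : 'M[R]_(m, N))
    (delta : R) (x : 'cV[R]_N) (S T J : {set 'I_N}) :
  RIP Phi (3 * K) delta -> delta < 1 -> supported S x ->
  (#|S| <= K)%N -> (#|T| <= K)%N ->
  largest K [set: 'I_N] (Phi^T *m resid (Phi *m x) (cols Phi T)) J ->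
  \sum_(i in S :\: (T :|: J)) x i 0 ^+ 2
    <= 2 * delta ^+ 2 * dot (sp_error Phi x T) (sp_error Phi x T).
Proof.
move=> rip d1 xS SK TK lJ; set e := sp_error Phi x T.
have JK : #|J| = K by case: lJ.
set B := S :|: T :|: J.
have Bn : (#|B| <= 3 * K)%N.
  have := (leq_card_setU (S :|: T) J).1; have := (leq_card_setU S T).1.
  by rewrite -/B; lia.
have eB : supported B e.
  exact: supportedS (finset.subsetUl _ _) (error_supported Phi xS).
set g := Phi^T *m resid (Phi *m x) (cols Phi T).
set u := restr (~: T) e.
have uS : supported S u.
  move=> i iS; rewrite mxE inE; case: ifP => // iT.
  by rewrite /e error_out ?iT // xS.
have JA : J \subset J :|: S by exact: finset.subsetUl.
have lJ' := largestS JA (finset.subsetT _) lJ.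
have := largest_missed lJ' SK uS; rewrite -/g.
have := RIP_gram rip Bn eB; rewrite -resid_error -/g.
have : \sum_(i in J :|: S) (g - u) i 0 ^+ 2
    <= \sum_(i in J :|: S) (g - e) i 0 ^+ 2.
  have entryB (a b : 'cV[R]_N) i : (a - b) i 0 = a i 0 - b i 0.
    by rewrite mxE [X in _ + X]mxE.
  apply: ler_sum => i _; rewrite (entryB g u) (entryB g e) [u i 0]mxE inE.
  case: ifPn => //.
  rewrite negbK => iT; rewrite (normal_equations _ rip d1 _ iT) //.
    by rewrite subr0 expr0n sqr_ge0.
  by rewrite (leq_trans TK) // leq_pmull.
have : \sum_(i in J :|: S) (g - e) i 0 ^+ 2 <= \sum_(i in B) (g - e) i 0 ^+ 2.
  apply: sumsq_subset; rewrite finset.subUset finset.subsetUr /=.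
  by rewrite /B -finset.setUA finset.subsetUl.
have : \sum_(i in S :\: (T :|: J)) x i 0 ^+ 2
    <= \sum_(i in (J :|: S) :\: J) u i 0 ^+ 2.
  have -> : \sum_(i in S :\: (T :|: J)) x i 0 ^+ 2
      = \sum_(i in S :\: (T :|: J)) u i 0 ^+ 2.
    apply: eq_bigr => i; rewrite !inE negb_or => /andP[/andP[iT _] _].
    by rewrite mxE inE iT /e error_out.
  apply: sumsq_subset; apply/fintype.subsetP => i.
  by rewrite !inE negb_or => /andP[/andP[_ ->] ->]; rewrite orbT.
by lra.
Qed.

(** An entry of [x] lost by the pruned set either lay outside the expanded set
    [A] already or was discarded by the thresholding of [w]. *)
Lemma prune_missed (R : realType) (N K : nat) (A S : {set 'I_N})
    (x w : 'cV[R]_N) (J : {set 'I_N}) :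
  largest K A w J -> (#|S| <= K)%N -> supported S x ->
  \sum_(i in S :\: J) x i 0 ^+ 2 <=
    \sum_(i in S :\: A) x i 0 ^+ 2 + 2 * \sum_(i in A) (x - w) i 0 ^+ 2.
Proof.
move=> lJ SK xS; have JA : J \subset A by case: lJ.
have := largest_missed lJ SK xS.
have -> : \sum_(i in A) (w - x) i 0 ^+ 2
    = \sum_(i in A) (x - w) i 0 ^+ 2.
  by apply: eq_bigr => i _; rewrite !mxE -sqrrN opprB.
rewrite [X in _ -> X <= _](big_setID A) /=.
have -> : (S :\: J) :\: A = S :\: A.
  by rewrite finset.setDDl (finset.setUidPr JA).
have sub : (S :\: J) :&: A \subset A :\: J.
  by apply/fintype.subsetP => i; rewrite !inE => /andP[/andP[-> _] ->].
by have := sumsq_subset x sub; lra.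
Qed.

(** The squared residual on [T'] is bounded through [resid_min] by comparison
    with [x] restricted to [T'], whose residual is the image of the missed part
    of [x]. *)
Lemma sp_contraction (R : realType) (m N K : nat) (Phi : 'M[R]_(m, N))
    (x : 'cV[R]_N) (S T T' : {set 'I_N}) :
  RIP Phi (3 * K) (165 / 1000) -> supported S x ->
  (#|S| <= K)%N -> (#|T| <= K)%N ->
  sp_candidate K Phi (Phi *m x) T T' ->
  norm2 (resid (Phi *m x) (cols Phi T')) ^+ 2
    <= 1 / 4 * norm2 (resid (Phi *m x) (cols Phi T)) ^+ 2.
Proof.
move=> rip xS SK TK [J lJ /= lT']; rewrite !norm2_sq.
set r := resid _ (cols Phi T); set r' := resid _ (cols Phi T').
have d1 : (165 / 1000 : R) < 1 by lra.
have JK : #|J| = K by case: lJ.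
have T'K : #|T'| = K by case: lT'.
have le_3K n : (n <= K)%N -> (n <= 3 * K)%N by lia.
have T'n : (#|T'| <= 3 * K)%N by rewrite T'K le_3K.
have STn' : (#|S :\: T'| <= 3 * K)%N.
  by rewrite le_3K // (leq_trans (subset_leq_card (finset.subsetDl S T'))).
have STn : (#|S :|: T| <= 3 * K)%N.
  by have := (leq_card_setU S T).1; lia.
have SAn : (#|S :|: (T :|: J)| <= 3 * K)%N.
  by have := (leq_card_setU S (T :|: J)).1; have := (leq_card_setU T J).1; lia.
have step1 := expand_missed rip d1 xS SK TK lJ.
have step2 := error_inside rip d1 SAn xS.
have step3 := error_missed rip d1 SAn xS.
have step4 := prune_missed lT' SK xS.
rewrite -/(sp_estimate _ _ _) -/(sp_error _ _ _) in step4.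
have [/andP[lo _]] := RIP_dot rip STn (error_supported Phi xS (I := T)).
have missed : supported (S :\: T') (restr (S :\: T') x).
  exact: restr_supported.
have /andP[_ hi] := RIP_dot rip STn' missed.
have := resid_min (Phi *m x) rip d1 T'n (restr_supported x (I := T')).
have -> : Phi *m x - Phi *m restr T' x = Phi *m restr (S :\: T') x.
  rewrite -mulmxBr; congr (_ *m _); apply/colP => i; rewrite !mxE inE.
  case: (i \in T'); rewrite /= ?subrr ?subr0 //.
  by case: ifPn => // /xS.
rewrite -/r'; move: hi; rewrite (supported_dot missed).
have -> : \sum_(i in S :\: T') restr (S :\: T') x i 0 ^+ 2
    = \sum_(i in S :\: T') x i 0 ^+ 2.
  by apply: eq_bigr => i iS; rewrite mxE iS.
by move: lo; rewrite -resid_error -/r; have := dot_ge0 r; lra.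
Qed.

(** * Termination and exact recovery *)

Lemma resid0_estimate (R : realType) (m N K : nat) (Phi : 'M[R]_(m, N))
    (delta : R) (x : 'cV[R]_N) (S T : {set 'I_N}) :
  RIP Phi (3 * K) delta -> delta < 1 -> supported S x ->
  (#|S| <= K)%N -> (#|T| <= K)%N ->
  resid (Phi *m x) (cols Phi T) = 0 -> sp_estimate Phi (Phi *m x) T = x.
Proof.
move=> rip d1 xS SK TK r0.
have STn : (#|S :|: T| <= 3 * K)%N by have := (leq_card_setU S T).1; lia.
have := RIP_dot rip STn (error_supported Phi xS (I := T)).
rewrite -resid_error r0; set e := sp_error _ _ _; have e0 := dot_ge0 e.
have -> : dot (0 : 'cV[R]_m) 0 = 0 by rewrite /dot mulmx0 mxE.
move=> /andP[lo _]; have /dot_eq0 : dot e e = 0 by nra.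
by move/eqP; rewrite subr_eq0 => /eqP.
Qed.

Theorem theorem1 (R : realType) (m N K : nat) (Phi : 'M[R]_(m, N))
    (x : 'cV[R]_N) (y : 'cV[R]_m)
    (hx : sparse K x)
    (hy : y = Phi *m x)
    (hRIP : (RIP_const Phi (3 * K) < (165 / 1000)%:E)%E)
    (s : nat -> {set 'I_N} * bool)
    (hs : sp_run K Phi y s) :
  exists l0 : nat, forall l : nat, (l0 <= l)%N ->
    sp_estimate Phi y (s l).1 = x.
Proof.
have rip : RIP Phi (3 * K) (165 / 1000).
  have [_ [d ripd <-]] := ereal_inf_lt hRIP.
  by rewrite lte_fin => dlt; apply: RIP_weaken ripd; lra.
have d1 : (165 / 1000 : R) < 1 by lra.
subst y; set S := [set i | (x i 0 != 0)%R].
have xS : supported S x by move=> i; rewrite inE negbK => /eqP.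
have [[_ T0K _] q0 step] := hs.
pose f (T : {set 'I_N}) := norm2 (resid (Phi *m x) (cols Phi T)).
have f0P T : f T = 0 -> resid (Phi *m x) (cols Phi T) = 0.
  by move=> fT; apply: dot_eq0; rewrite -norm2_sq -/(f T) fT expr0n.
have f_ge0 T : 0 <= f T by exact: sqrtr_ge0.
have card_run l : #|(s l).1| = K.
  elim: l => // l IH; move: (step l); rewrite /sp_step.
  case: ifP => [_ -> //|_ [T' [J _ [_ T'K _]] ->]].
  by case: ifP.
have stay l : f (s l).1 = 0 -> f (s l.+1).1 = 0.
  move=> fl; move: (step l); rewrite /sp_step.
  case: ifP => [_ -> //|_ [T' _ ->]]; rewrite -/(f _) -/(f _) fl.
  case: ifPn => //=; rewrite -leNgt => fT'.
  by apply/eqP; rewrite eq_le fT' f_ge0.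
have decrease l : f (s l).1 != 0 -> (s l).2 = false ->
    f (s l.+1).1 < f (s l).1 /\ (s l.+1).2 = false.
  move=> fN0 ql; move: (step l); rewrite /sp_step ql => -[T' cand].
  have lt : f T' < f (s l).1.
    have TK : (#|(s l).1| <= K)%N by rewrite card_run.
    have := sp_contraction rip xS hx TK cand; rewrite -!/(f _).
    have fp : 0 < f (s l).1 by rewrite lt_def fN0 f_ge0.
    have : 0 < f (s l).1 ^+ 2 by rewrite exprn_gt0.
    move=> p c; rewrite -(ltr_pXn2r (n := 2)) ?nnegrE //; lra.
  by rewrite -!/(f _) ltNge (ltW lt) /= => ->.
(* The number of index sets with a smaller residual drops at each step. *)
pose rank l := #|[set T | f T < f (s l).1]|.
have [l0 fl0] : exists l, f (s l).1 = 0.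
  have : forall k l, (rank l <= k)%N -> (s l).2 = false ->
      exists l', f (s l').1 = 0.
    elim=> [|k IH] l lk ql; have [|fN0] := eqVneq (f (s l).1) 0;
      try by exists l.
    - have [lt _] := decrease l fN0 ql.
      move: lk; rewrite leqn0 cards_eq0 => /eqP/setP/(_ (s l.+1).1).
      by rewrite !inE lt.
    - have [lt q'] := decrease l fN0 ql; apply: (IH l.+1) => //.
      rewrite -ltnS; apply: leq_trans lk; apply: proper_card.
      apply/fintype.properP; split.
        by apply/fintype.subsetP => T; rewrite !inE => /lt_trans; apply.
      by exists (s l.+1).1; rewrite !inE ?ltxx.
  by move=> /(_ _ 0%N (leqnn _) q0).
exists l0 => l l0l; apply: (resid0_estimate rip d1 xS hx).
  by rewrite card_run.
apply: f0P; rewrite -(subnKC l0l); elim: (l - l0)%N => [|k IH].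
  by rewrite addn0.
by rewrite addnS; apply: stay.
Qed.
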